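(* For all real numbers $[a],[b]\in\mathcal{S}_{\mathbb{R}}$ such that $[a]\le[b]$, and all (non-zero) real numbers $[c]$ such that $\sigma([c])=1$, we have $[a]*[c]\le[b]*[c]$.
   Context: Conventions. $\omega=\{0,1,2,\dots\}$, $\omega_+=\omega\setminus\{0\}$, $[a,b]_\omega=\{n\in\omega:a\le n\le b\}$, $[a,\infty]_\omega=\{n\in\omega:n\ge a\}$; empty products equal $1$. A system function $\vartheta:\omega_+\to[2,\infty]_\omega$ is fixed. Contractions. For $f:\omega\to\omega$ and $n\in\omega_+$, the contraction $c_n$ is applicable to $f$ iff $f(n+1)\ge\vartheta(n)$, and then $c_n(f)(n)=f(n)+1$, $c_n(f)(n+1)=f(n+1)-\vartheta(n)$, $c_n(f)(k)=f(k)$ for other $k$. A sequence of contractions is a finite (possibly empty) composition of contractions; it is applicable to $f$ iff each contraction in turn is applicable to the result of the preceding ones. Sign. For $f:\omega\to\omega$, $\sigma(f)=0$ if $f(0)$ is odd and $\sigma(f)=1$ if $f(0)$ is even. Auxiliary functions. $h:\omega\to\omega$ is a primary auxiliary function ($h\in A_p$) if $h(k)<\vartheta(k-1)$ for all $k\ge2$ and for every $N\in\omega_+$ there is $M\ge N+1$ with $h(M)\ne\vartheta(M-1)-1$. It is a secondary auxiliary function ($h\in A_s$) if $h(k)<\vartheta(k-1)$ for all $k\ge2$ and there is $N\in\omega_+$ with $h(M)=\vartheta(M-1)-1$ for all $M\ge N+1$; the least such $N$ is $N^h_{\min}$. Base set. $W_1$ is the set of pairs $(h_p,h_s)\in A_p\times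 A_s$ such that, with $N=N^{h_s}_{\min}$, $h_p(k)=h_s(k)$ for $k<N$, $h_p(N)=h_s(N)+1$, and $h_p(k)=0$ for $k>N$. Two pairs in $W_1$ are equivalent if their first components agree on $\omega_+$ and have the same sign; $F$ is the collection of sets obtained by taking, for each equivalence class, the set of all functions that are components of its pairs. $W_2$ is the set of primary auxiliary functions occurring in no pair of $W_1$; two elements of $W_2$ are equivalent if they agree on $\omega_+$ and have the same sign; $G_2$ is the set of equivalence classes. The base set is $B=F\cup G_2$. Real numbers. For $b\in B$, $r_b$ is the set of $f:\omega\to\omega$ for which there is $h\in b$ such that for every $N\in\omega_+$ some sequence of contractions $\mathcal{C}$ applicable to $f$ satisfies $\mathcal{C}(f)(n)=h(n)$ for all $n\in[0,N]_\omega$. Let $b_1,b_2\in B$ be the elements containing respectively the zero function, and the function with value $1$ at $0$ and $0$ elsewhere. $\mathcal{S}_{\mathbb{R}}$ (the set of real numbers) consists of all $r_b$ with $b\in B\setminus\{b_1,b_2\}$ together with $[0]:=r_{b_1}\cup r_{b_2}$. Put $\mathcal{S}_{\mathbb{R}}^*=\mathcal{S}_{\mathbb{R}}\setminus\{[0]\}$. Distinct real numbers are disjoint. A function lying in some real number is called finite, and $[f]$ denotes the real number containing $f$. For $[a]\in\mathcal{S}_{\mathbb{R}}^*$ all elements have the same sign, denoted $\sigma([a])$; $\sigma$ is not defined on $[0]$. Order. For $[a],[b]\in\mathcal{S}_{\mathbb{R}}^*$, $[a]\le[b]$ iff one of the following holds: (i) $\sigma([a])<\sigma([b])$; (ii)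 $\sigma([a])=\sigma([b])=1$ and for every $a\in[a]$ there is $b\in[b]$ with $a(n)\le b(n)$ for all $n\in\omega_+$; (iii) $\sigma([a])=\sigma([b])=0$ and for every $b\in[b]$ there is $a\in[a]$ with $a(n)\ge b(n)$ for all $n\in\omega_+$. For $[a]\in\mathcal{S}_{\mathbb{R}}^*$, $[a]\le[0]$ iff $\sigma([a])=0$, and $[0]\le[a]$ iff $\sigma([a])=1$. Finally $[0]\le[0]$ holds. Multiplication. For $a,b\in\omega$ let $\Upsilon(a,b)=\max\{a,b\}-\min\{a,b\}$. For $n,k,K\in\omega_+$ let $$R(n,k,K)=\max\Big\{t\in\omega:\ t\prod_{j=1}^{n-1}\vartheta(j)\prod_{j=1}^{k-1}\vartheta(j)\le\prod_{j=1}^{K-1}\vartheta(j)\Big\}.$$ The rest function is $r(n,k,1)=R(n,k,1)$ and $r(n,k,M)=\Upsilon\big(R(n,k,M),\ \vartheta(M-1)R(n,k,M-1)\big)$ for $M\ge2$. For finite $f,g$ the sub-product $f*g:\omega\to\omega$ is $(f*g)(0)=f(0)+g(0)$ and $(f*g)(M)=\sum_{n=1}^M\sum_{k=1}^M f(n)g(k)\,r(n,k,M)$ for $M\in\omega_+$. Multiplication of real numbers: $[f]*[g]:=[f*g]$ for any $f\in[f]$, $g\in[g]$ (independent of the choice of representatives). *)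

(* Defs.v *)
From mathcomp Require Import all_boot.
From mathcomp Require Import boolp classical_sets.
Set Implicit Arguments.
Unset Strict Implicit.
Unset Printing Implicit Defensive.
Local Open Scope classical_set_scope.

(* Functions omega -> omega are [nat -> nat]. The system function lives on
   positive integers: the value [theta 0] is never used. *)
Definition system_function (theta : nat -> nat) : Prop :=
  forall n, 0 < n -> 2 <= theta n.

Definition contraction (theta : nat -> nat) (n : nat) (f : nat -> nat) :
    nat -> nat :=
  fun k => if k == n then f n + 1
           else if k == n.+1 then f n.+1 - theta n
           else f k.

(* A sequence of contractions is the list of its indices, the head being
   performed first. *)
Fixpoint applicable (theta : nat -> nat) (s : seq nat) (f : nat -> nat) : bool :=
  if s is n :: s' then
    [&& 0 < n, theta n <= f n.+1 & applicable theta s' (contraction theta n f)]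
  else true.

Fixpoint contractions (theta : nat -> nat) (s : seq nat) (f : nat -> nat) :
    nat -> nat :=
  if s is n :: s' then contractions theta s' (contraction theta n f) else f.

Definition sign (f : nat -> nat) : nat := if odd (f 0) then 0 else 1.

Definition digits_bounded (theta h : nat -> nat) : Prop :=
  forall k, 2 <= k -> h k < theta k.-1.

Definition primary_aux (theta : nat -> nat) : set (nat -> nat) :=
  [set h | digits_bounded theta h /\
     forall N, 0 < N -> exists M, N.+1 <= M /\ h M <> theta M.-1 - 1].

Definition maximal_after (theta h : nat -> nat) (N : nat) : Prop :=
  0 < N /\ forall M, N.+1 <= M -> h M = theta M.-1 - 1.

Definition secondary_aux (theta : nat -> nat) : set (nat -> nat) :=
  [set h | digits_bounded theta h /\ exists N, maximal_after theta h N].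

Definition is_Nmin (theta h : nat -> nat) (N : nat) : Prop :=
  maximal_after theta h N /\ forall N', maximal_after theta h N' -> N <= N'.

Definition W1 (theta : nat -> nat) : set ((nat -> nat) * (nat -> nat)) :=
  [set p | primary_aux theta p.1 /\ secondary_aux theta p.2 /\
     exists N, is_Nmin theta p.2 N /\
       (forall k, k < N -> p.1 k = p.2 k) /\
       p.1 N = p.2 N + 1 /\
       (forall k, N < k -> p.1 k = 0)].

Definition aux_equiv (h h' : nat -> nat) : Prop :=
  (forall n, 0 < n -> h n = h' n) /\ sign h = sign h'.

Definition F_sets (theta : nat -> nat) : set (set (nat -> nat)) :=
  [set b | exists p, W1 theta p /\
     b = [set h | exists q, W1 theta q /\ aux_equiv p.1 q.1 /\
                    (h = q.1 \/ h = q.2)]].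

Definition W2 (theta : nat -> nat) : set (nat -> nat) :=
  [set h | primary_aux theta h /\
     forall p, W1 theta p -> h <> p.1 /\ h <> p.2].

Definition G2_sets (theta : nat -> nat) : set (set (nat -> nat)) :=
  [set b | exists h, W2 theta h /\ b = [set h' | W2 theta h' /\ aux_equiv h h']].

Definition base_set (theta : nat -> nat) : set (set (nat -> nat)) :=
  F_sets theta `|` G2_sets theta.

Definition r_set (theta : nat -> nat) (b : set (nat -> nat)) : set (nat -> nat) :=
  [set f | exists h, b h /\
     forall N, 0 < N -> exists s, applicable theta s f /\
       forall n, n <= N -> contractions theta s f n = h n].

(* "The element of B containing h"; [set0] is a dummy value. *)
Definition base_elt (theta h : nat -> nat) : set (nat -> nat) :=
  xget set0 [set b | base_set theta b /\ b h].

Definition b1 (theta : nat -> nat) : set (nat -> nat) :=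
  base_elt theta (fun _ => 0).

Definition b2 (theta : nat -> nat) : set (nat -> nat) :=
  base_elt theta (fun n => if n == 0 then 1 else 0).

Definition real_zero (theta : nat -> nat) : set (nat -> nat) :=
  r_set theta (b1 theta) `|` r_set theta (b2 theta).

Definition real_numbers (theta : nat -> nat) : set (set (nat -> nat)) :=
  [set x | (exists b, base_set theta b /\ b <> b1 theta /\ b <> b2 theta /\
              x = r_set theta b)
           \/ x = real_zero theta].

(* The common sign of the elements of [x]; meaningful for nonzero real numbers
   only, the value for [real_zero] being a dummy that is never consulted. *)
Definition real_sign (x : set (nat -> nat)) : nat :=
  xget 0 [set s | forall f, x f -> sign f = s].

Definition real_le_nonzero (x y : set (nat -> nat)) : Prop :=
  real_sign x < real_sign y
  \/ (real_sign x = 1 /\ real_sign y = 1 /\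
      forall f, x f -> exists g, y g /\ forall n, 0 < n -> f n <= g n)
  \/ (real_sign x = 0 /\ real_sign y = 0 /\
      forall g, y g -> exists f, x f /\ forall n, 0 < n -> g n <= f n).

Definition real_le (theta : nat -> nat) (x y : set (nat -> nat)) : Prop :=
  let z := real_zero theta in
  (x <> z /\ y <> z /\ real_le_nonzero x y)
  \/ (x <> z /\ y = z /\ real_sign x = 0)
  \/ (x = z /\ y <> z /\ real_sign y = 1)
  \/ (x = z /\ y = z).

Definition upsilon (a b : nat) : nat := maxn a b - minn a b.

Definition theta_prod (theta : nat -> nat) (n : nat) : nat :=
  \prod_(1 <= j < n) theta j.

(* The maximum over all natural [t]: since [theta_prod] is positive, every
   admissible [t] is at most [theta_prod theta K] (see [RcoefP]). *)
Definition Rcoef (theta : nat -> nat) (n k K : nat) : nat :=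
  \max_(t < (theta_prod theta K).+1 |
        t * theta_prod theta n * theta_prod theta k <= theta_prod theta K) t.

Lemma theta_prod_gt0 theta n : system_function theta -> 0 < theta_prod theta n.
Proof.
move=> sf; rewrite /theta_prod big_nat_cond prodn_cond_gt0 // => j.
by rewrite andbT => /andP[j_gt0 _]; apply: leq_trans (sf j j_gt0).
Qed.

Lemma RcoefP theta n k K : system_function theta ->
  Rcoef theta n k K * theta_prod theta n * theta_prod theta k
    <= theta_prod theta K /\
  forall t, t * theta_prod theta n * theta_prod theta k <= theta_prod theta K ->
    t <= Rcoef theta n k K.
Proof.
move=> sf; split=> [|t tP].
  rewrite /Rcoef; elim/big_ind: _ => // x y Hx Hy.
  by rewrite /maxn; case: ifP.
have tK : t < (theta_prod theta K).+1.
  rewrite ltnS; apply: leq_trans tP.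
  by rewrite -mulnA leq_pmulr // muln_gt0 !theta_prod_gt0.
exact: (@leq_bigmax_cond _ _ (fun i : 'I_(theta_prod theta K).+1 => i : nat)
          (Ordinal tK)).
Qed.

(* Used for positive arguments only. *)
Definition rest (theta : nat -> nat) (n k M : nat) : nat :=
  if M <= 1 then Rcoef theta n k 1
  else upsilon (Rcoef theta n k M) (theta M.-1 * Rcoef theta n k M.-1).

Definition subproduct (theta f g : nat -> nat) : nat -> nat :=
  fun M => if M == 0 then f 0 + g 0
           else \sum_(1 <= n < M.+1) \sum_(1 <= k < M.+1)
                  f n * g k * rest theta n k M.

(* The real number [f * g], for any representatives [f] of [x] and [g] of [y];
   [set0] is a dummy value. *)
Definition real_mul (theta : nat -> nat) (x y : set (nat -> nat)) :
    set (nat -> nat) :=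
  xget set0 [set z | real_numbers theta z /\
    forall f g, x f -> y g -> z (subproduct theta f g)].

(* Main.v *)
(* A function f is the digit sequence of the number V(f) = sum_n f(n)/P(n),
   where P(n) = theta(1)...theta(n-1).  Contractions preserve V, and the
   auxiliary functions are the expansions with bounded digits, the pairs of W_1
   being the two expansions of a terminating number; hence a nonzero real
   number is the set of all f with a given sign and a given finite V(f).  The
   numbers r(n,k,M), M >= 1, are the digits of 1/(P(n)P(k)), so that
   V(f * g) = V(f)V(g).  As f |-> f * k is monotone for the pointwise order, a
   pointwise witness f <= g of [a] <= [b] yields the one needed for
   F in [a] * [c], namely F + (g * k - f * k). *)
Require Import Defs.
From mathcomp Require Import all_boot all_order all_algebra.
From mathcomp Require Import boolp classical_sets reals Rstruct.
From mathcomp Require Import zify ring lra.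
Import Order.TTheory GRing.Theory Num.Theory.

Set Implicit Arguments.
Unset Strict Implicit.
Unset Printing Implicit Defensive.

Section Value.
Local Open Scope ring_scope.
Local Open Scope classical_set_scope.
Variables (R : realType) (theta : nat -> nat).
Hypothesis htheta : system_function theta.

(** * Weights, partial sums and values *)

Definition weight (n : nat) : R := (theta_prod theta n)%:R^-1.

Definition psum (f : nat -> nat) (N : nat) : R :=
  \sum_(1 <= n < N.+1) (f n)%:R * weight n.

Definition finite_fun (f : nat -> nat) := exists B : R, forall N, psum f N <= B.

(** On an unbounded set [sup] has a default value, so lemmas bounding partial sums by [value] assume
    [finite_fun]. *)
Definition value (f : nat -> nat) : R := sup (range (psum f)).

Lemma theta_prodS n : (0 < n)%N ->
  theta_prod theta n.+1 = (theta n * theta_prod theta n)%N.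
Proof. by move=> n0; rewrite /theta_prod big_nat_recr//= mulnC. Qed.

Lemma weight_gt0 n : 0 < weight n.
Proof. by rewrite invr_gt0 ltr0n theta_prod_gt0. Qed.

Lemma weight_ge0 n : 0 <= weight n. Proof. exact/ltW/weight_gt0. Qed.

Lemma weightS n : (0 < n)%N -> weight n = (theta n)%:R * weight n.+1.
Proof.
move=> n0; rewrite /weight theta_prodS// natrM invfM mulrA mulfV ?mul1r//.
by rewrite pnatr_eq0 -lt0n (leq_trans _ (htheta n0)).
Qed.

Lemma theta_prod_ltn n m : (0 < n)%N -> (n < m)%N ->
  (theta_prod theta n < theta_prod theta m)%N.
Proof.
move=> n0; elim: m => // m IH; rewrite ltnS leq_eqVlt => nm.
have m0 : (0 < m)%N by case/orP: nm => [/eqP <-//|]; apply: leq_trans.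
have PS : (theta_prod theta m < theta_prod theta m.+1)%N.
  by rewrite theta_prodS// ltn_Pmull ?htheta ?theta_prod_gt0.
by case/orP: nm => [/eqP ->//|/IH]; lia.
Qed.

Lemma theta_prod_ge n : (n <= theta_prod theta n)%N.
Proof.
elim: n => // n IH; case: n IH => [|n] IH; first by rewrite theta_prod_gt0.
exact: leq_ltn_trans IH (theta_prod_ltn _ _).
Qed.

Lemma weight_le_inv n : (0 < n)%N -> weight n <= n%:R^-1.
Proof.
move=> n0; rewrite /weight lef_pV2 ?posrE ?ltr0n ?theta_prod_gt0//.
by rewrite ler_nat theta_prod_ge.
Qed.

(** Stands in for a passage to the limit: [weight M <= 1/M] tends to 0, so [c * weight M] eventually
    drops below any positive gap [x - y]. *)
Lemma le_of_weight_slack (x y c : R) K :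
  (forall M, (K <= M)%N -> x <= y + c * weight M) -> x <= y.
Proof.
move=> H; rewrite leNgt; apply/negP => yx.
pose d := `|c| / (x - y).
have d0 : 0 <= d by rewrite divr_ge0// subr_ge0 ltW.
pose M := maxn K.+1 (Num.bound d).
have M0 : (0 < M)%N by rewrite /M; lia.
have dM : d < M%:R.
  by apply: lt_le_trans (archi_boundP d0) _; rewrite ler_nat leq_maxr.
have /H : (K <= M)%N by rewrite /M; lia.
apply/negP; rewrite -ltNge -ltrBrDl.
apply: (@le_lt_trans _ _ (`|c| * M%:R^-1)).
  apply: le_trans (ler_norm _) _; rewrite normrM (ger0_norm (weight_ge0 M)).
  by rewrite ler_wpM2l// weight_le_inv.
by rewrite ltr_pdivrMr ?ltr0n// mulrC -ltr_pdivrMr// subr_gt0.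
Qed.

Lemma psum0 f : psum f 0 = 0. Proof. by rewrite /psum big_geq. Qed.

Lemma psumS f N : psum f N.+1 = psum f N + (f N.+1)%:R * weight N.+1.
Proof. by rewrite /psum big_nat_recr. Qed.

Lemma psum_le f N M : (N <= M)%N -> psum f N <= psum f M.
Proof.
move=> /subnK <-; elim: (M - N)%N => // k IH.
by rewrite addSn psumS ler_wpDr// mulr_ge0// weight_ge0.
Qed.

Lemma psum_ge0 f N : 0 <= psum f N.
Proof. by rewrite -(psum0 f) psum_le. Qed.

Lemma eq_psum f g N : (forall n, (0 < n <= N)%N -> f n = g n) ->
  psum f N = psum g N.
Proof. by move=> fg; apply: eq_big_nat => n nN; rewrite fg. Qed.

Lemma psum_leqf f g N : (forall n, (0 < n)%N -> (f n <= g n)%N) ->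
  psum f N <= psum g N.
Proof.
move=> fg; rewrite /psum !big_nat; apply: ler_sum => n /andP[n0 _].
by rewrite ler_wpM2r ?weight_ge0// ler_nat fg.
Qed.

Lemma psumD f g N : psum (fun n => f n + g n)%N N = psum f N + psum g N.
Proof.
by rewrite /psum -big_split/=; apply: eq_bigr => n _; rewrite natrD mulrDl.
Qed.

Lemma psum_le_value f N : finite_fun f -> psum f N <= value f.
Proof.
move=> [B fB]; apply: ub_le_sup; last by exists N.
by exists B => _ [n _ <-].
Qed.

Lemma value_le f q : (forall N, psum f N <= q) -> value f <= q.
Proof.
move=> fq; apply: ge_sup => [|_ [n _ <-]//].
by exists (psum f 0); exists 0%N.
Qed.

Lemma value_ge0 f : finite_fun f -> 0 <= value f.
Proof. by move=> ff; rewrite -(psum0 f); apply: psum_le_value. Qed.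

Lemma eq_value f g : (forall n, (0 < n)%N -> f n = g n) -> value f = value g.
Proof.
move=> fg; rewrite /value; suff -> : psum f = psum g by [].
by apply/funext => N; apply: eq_psum => n /andP[/fg].
Qed.

Lemma eq_finite f g : (forall n, (0 < n)%N -> f n = g n) ->
  finite_fun f -> finite_fun g.
Proof.
move=> fg [B fB]; exists B => N; rewrite -(@eq_psum f)// => n /andP[n0 _].
exact: fg.
Qed.

Lemma finite_leq f g : (forall n, (0 < n)%N -> (f n <= g n)%N) ->
  finite_fun g -> finite_fun f.
Proof.
by move=> fg [B gB]; exists B => N; apply: le_trans (gB N); apply: psum_leqf.
Qed.

Lemma finiteD f g : finite_fun f -> finite_fun g ->
  finite_fun (fun n => f n + g n)%N.
Proof.
by move=> [B fB] [C gC]; exists (B + C) => N; rewrite psumD lerD.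
Qed.

Lemma valueD f g : finite_fun f -> finite_fun g ->
  value (fun n => f n + g n)%N = value f + value g.
Proof.
move=> ff fg; have ffg := finiteD ff fg; apply/le_anti/andP; split.
  by apply: value_le => N; rewrite psumD lerD ?psum_le_value.
(* The two suprema are bounded one after the other, with independent indices N and M; both partial
   sums are at most those at [maxn N M]. *)
rewrite -lerBrDr; apply: value_le => N; rewrite lerBrDl -lerBrDr.
apply: value_le => M; rewrite lerBrDl.
apply: le_trans _ (psum_le_value (maxn N M) ffg); rewrite psumD.
by rewrite lerD// psum_le// ?leq_maxl ?leq_maxr.
Qed.

Lemma finite_value_eq0 f : finite_fun f ->
  value f = 0 <-> (forall n, (0 < n)%N -> f n = 0%N).
Proof.
move=> ff; split=> [v0 [//|n] _|f0].
  have := psum_le_value n.+1 ff; rewrite v0 psumS => H.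
  have := psum_ge0 f n => H1; have w0 := weight_gt0 n.+1.
  have : (f n.+1)%:R * weight n.+1 <= 0 by lra.
  by rewrite pmulr_lle0// lern0 => /eqP.
apply/le_anti; rewrite value_ge0// andbT; apply: value_le => N.
by rewrite /psum big_nat big1// => n /andP[/f0->]; rewrite mul0r.
Qed.

(** * The sub-product *)

Lemma Rcoef_divn n k K :
  Rcoef theta n k K = (theta_prod theta K %/ (theta_prod theta n * theta_prod theta k))%N.
Proof.
have [H1 H2] := RcoefP n k K htheta.
have D0 : (0 < theta_prod theta n * theta_prod theta k)%N.
  by rewrite muln_gt0 !theta_prod_gt0.
apply/eqP; rewrite eqn_leq leq_divRL// mulnA H1 /=.
by apply: H2; rewrite -mulnA leq_trunc_div.
Qed.

Lemma Rcoef_eq0 n k K : (0 < K)%N -> (K < maxn n k)%N -> Rcoef theta n k K = 0%N.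
Proof.
move=> K0 Knk; rewrite Rcoef_divn divn_small//.
have Pn := theta_prod_gt0 n htheta; have Pk := theta_prod_gt0 k htheta.
move: Knk; rewrite leq_max => /orP[] /(theta_prod_ltn K0) H.
  by apply: leq_trans H _; rewrite leq_pmulr.
by apply: leq_trans H _; rewrite leq_pmull.
Qed.

Lemma rest_eq0 n k M : (0 < M)%N -> (M < maxn n k)%N -> rest theta n k M = 0%N.
Proof.
case: M => // -[|M] _ Mnk; rewrite /rest /=; first by rewrite Rcoef_eq0.
by rewrite /upsilon !Rcoef_eq0// ?muln0// ltnW.
Qed.

(** The absolute difference in [rest] is a true subtraction: [theta M * Rcoef theta n k M] is
    admissible in the maximum defining [Rcoef] at [M.+1]. *)
Lemma Rcoef_step n k M : (0 < M)%N ->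
  Rcoef theta n k M.+1 = (theta M * Rcoef theta n k M + rest theta n k M.+1)%N.
Proof.
case: M => // M _; rewrite /rest /= /upsilon.
have H : (theta M.+1 * Rcoef theta n k M.+1 <= Rcoef theta n k M.+2)%N.
  apply: (RcoefP n k M.+2 htheta).2; rewrite -!mulnA theta_prodS// leq_mul2l.
  by rewrite mulnA (RcoefP n k M.+1 htheta).1 orbT.
by rewrite (maxn_idPl H) (minn_idPr H) subnKC.
Qed.

(** Telescoping of [Rcoef_step]. With [Rcoef_divn], the partial sum is 1/(P(n)P(k)) rounded down to
    a multiple of 1/P(M), whence the next two bounds. *)
Lemma psum_rest n k M : (0 < M)%N ->
  psum (rest theta n k) M = (Rcoef theta n k M)%:R * weight M.
Proof.
case: M => // M _; elim: M => [|M IH]; first by rewrite psumS psum0 add0r.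
rewrite psumS IH (@Rcoef_step _ _ M.+1)// (@weightS M.+1)//.
by rewrite natrD natrM; ring.
Qed.

Lemma psum_rest_le n k M : psum (rest theta n k) M <= weight n * weight k.
Proof.
case: M => [|M]; first by rewrite psum0 mulr_ge0 ?weight_ge0.
rewrite psum_rest// Rcoef_divn /weight -invfM -natrM.
rewrite ler_pdivrMr ?ltr0n ?theta_prod_gt0// mulrC ler_pdivlMr; last first.
  by rewrite ltr0n muln_gt0 !theta_prod_gt0.
by rewrite -natrM ler_nat leq_trunc_div.
Qed.

Lemma psum_rest_ge n k M : (0 < M)%N ->
  weight n * weight k <= psum (rest theta n k) M + weight M.
Proof.
move=> M0; have D0 : (0 < theta_prod theta n * theta_prod theta k)%N.
  by rewrite muln_gt0 !theta_prod_gt0.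
rewrite psum_rest// Rcoef_divn -[X in _ <= _ + X]mul1r -mulrDl natr1.
rewrite /weight -invfM -natrM.
rewrite ler_pdivlMr ?ltr0n ?theta_prod_gt0// mulrC ler_pdivrMr ?ltr0n//.
by rewrite -natrM ler_nat ltnW// ltn_ceil.
Qed.

Lemma sum_nat_widen (F : nat -> nat) M N : (M <= N)%N ->
  (forall n, (M < n)%N -> F n = 0%N) ->
  (\sum_(1 <= n < M.+1) F n = \sum_(1 <= n < N.+1) F n)%N.
Proof.
move=> MN F0; rewrite [RHS](@big_cat_nat _ _ _ M.+1)//=.
by rewrite [X in (_ + X)%N]big_nat [X in (_ + X)%N]big1 ?addn0// => n /andP[/F0].
Qed.

Lemma ler_sum_widen (F : nat -> R) M N : (M <= N)%N -> (forall n, 0 <= F n) ->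
  \sum_(1 <= n < M.+1) F n <= \sum_(1 <= n < N.+1) F n.
Proof.
by move=> MN F0; rewrite [leRHS](@big_cat_nat _ _ _ M.+1)//= lerDl sumr_ge0.
Qed.

(** Terms with n or k above M vanish by [rest_eq0]. Using one index square for all M up to N lets
    the sum over M be exchanged with those over n and k. *)
Lemma subproduct_widen f g M N : (0 < M <= N)%N ->
  subproduct theta f g M = (\sum_(1 <= n < N.+1) \sum_(1 <= k < N.+1)
     f n * g k * rest theta n k M)%N.
Proof.
move=> /andP[M0 MN]; rewrite /subproduct eqn0Ngt M0 /=.
rewrite (sum_nat_widen MN); last first.
  move=> n Mn; rewrite big1// => k _.
  by rewrite rest_eq0 ?muln0// leq_max Mn.
apply: eq_bigr => n _; apply: sum_nat_widen => // k Mk.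
by rewrite rest_eq0 ?muln0// leq_max Mk orbT.
Qed.

Lemma psum_subproduct f g N : psum (subproduct theta f g) N =
  \sum_(1 <= n < N.+1) \sum_(1 <= k < N.+1)
     (f n)%:R * (g k)%:R * psum (rest theta n k) N.
Proof.
transitivity (\sum_(1 <= M < N.+1) \sum_(1 <= n < N.+1) \sum_(1 <= k < N.+1)
     (f n)%:R * (g k)%:R * ((rest theta n k M)%:R * weight M)).
  apply: eq_big_nat => M MN; rewrite (@subproduct_widen _ _ _ N)//.
  rewrite natr_sum mulr_suml; apply: eq_bigr => n _.
  rewrite natr_sum mulr_suml; apply: eq_bigr => k _.
  by rewrite !natrM mulrA.
rewrite exchange_big; apply: eq_bigr => n _.
rewrite exchange_big; apply: eq_bigr => k _.
by rewrite /psum mulr_sumr.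
Qed.

Lemma psumM f g N : psum f N * psum g N =
  \sum_(1 <= n < N.+1) \sum_(1 <= k < N.+1)
     (f n)%:R * (g k)%:R * (weight n * weight k).
Proof.
rewrite /psum mulr_suml; apply: eq_bigr => n _.
by rewrite mulr_sumr; apply: eq_bigr => k _; rewrite mulrACA.
Qed.

Lemma psum_subproduct_le f g N :
  psum (subproduct theta f g) N <= psum f N * psum g N.
Proof.
rewrite psum_subproduct psumM; apply: ler_sum => n _; apply: ler_sum => k _.
by rewrite ler_wpM2l ?psum_rest_le// mulr_ge0.
Qed.

(** Each pair (n, k) loses at most [weight M] to rounding. The number of pairs depends on N alone,
    so for fixed N the total error vanishes as M grows. *)
Lemma psum_subproduct_ge f g N M : (0 < M)%N -> (N <= M)%N ->
  psum f N * psum g N <= psum (subproduct theta f g) M +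
    (\sum_(1 <= n < N.+1) \sum_(1 <= k < N.+1) (f n)%:R * (g k)%:R) * weight M.
Proof.
move=> M0 NM; rewrite psum_subproduct psumM.
have T0 n k : 0 <= (f n)%:R * (g k)%:R * psum (rest theta n k) M.
  by rewrite mulr_ge0 ?psum_ge0// mulr_ge0.
apply: (@le_trans _ _ (\sum_(1 <= n < N.+1) \sum_(1 <= k < N.+1)
  (f n)%:R * (g k)%:R * psum (rest theta n k) M +
    (\sum_(1 <= n < N.+1) \sum_(1 <= k < N.+1) (f n)%:R * (g k)%:R) * weight M)).
  rewrite mulr_suml -big_split; apply: ler_sum => n _ /=.
  rewrite mulr_suml -big_split; apply: ler_sum => k _ /=.
  by rewrite -mulrDr ler_wpM2l ?psum_rest_ge// mulr_ge0.
rewrite lerD2r; apply: le_trans (ler_sum_widen NM _); last first.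
  by move=> n; apply: sumr_ge0.
by apply: ler_sum => n _; apply: ler_sum_widen.
Qed.

Lemma finite_subproduct f g : finite_fun f -> finite_fun g ->
  finite_fun (subproduct theta f g).
Proof.
move=> ff fg; exists (value f * value g) => N.
apply: le_trans (psum_subproduct_le _ _ _) _.
by rewrite ler_pM ?psum_ge0 ?psum_le_value.
Qed.

Lemma value_subproduct f g : finite_fun f -> finite_fun g ->
  value (subproduct theta f g) = value f * value g.
Proof.
move=> ff fg; have ffg := finite_subproduct ff fg; apply/le_anti/andP; split.
  apply: value_le => N; apply: le_trans (psum_subproduct_le _ _ _) _.
  by rewrite ler_pM ?psum_ge0 ?psum_le_value.
(* Division by c passes the bound to the supremum; for c = 0 the bound at N = 0 already says
   [0 <= q]. *)
have le_cst h c q : (forall N, psum h N * c <= q) -> 0 <= c -> value h * c <= q.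
  move=> hq; rewrite le_eqVlt => /predU1P[c0|c0].
    by have := hq 0%N; rewrite -c0 !mulr0.
  by rewrite -ler_pdivlMr//; apply: value_le => N; rewrite ler_pdivlMr.
apply: (le_cst); last exact: value_ge0.
move=> N; rewrite mulrC; apply: (le_cst); last exact: psum_ge0.
move=> N'; rewrite mulrC; pose L := maxn N N'.
apply: (@le_trans _ _ (psum f L * psum g L)).
  by rewrite ler_pM ?psum_ge0// psum_le ?leq_maxl ?leq_maxr.
pose c : R := \sum_(1 <= n < L.+1) \sum_(1 <= k < L.+1) (f n)%:R * (g k)%:R.
apply: (@le_of_weight_slack _ _ c L.+1) => M LM.
apply: le_trans (psum_subproduct_ge _ _ (leq_ltn_trans _ LM) (ltnW LM)) _ => //.
by rewrite -/c lerD2r psum_le_value.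
Qed.

(** * Contractions and digits *)

Lemma contractions_cat s1 s2 f :
  contractions theta (s1 ++ s2) f = contractions theta s2 (contractions theta s1 f).
Proof. by elim: s1 f => //= n s1 IH f. Qed.

Lemma applicable_cat s1 s2 f : applicable theta (s1 ++ s2) f =
  applicable theta s1 f && applicable theta s2 (contractions theta s1 f).
Proof. by elim: s1 f => //= n s1 IH f; rewrite IH !andbA. Qed.

(** A contraction trades [theta n] units at place n+1 for one unit of equal total weight at place n;
    only the partial sum that stops between the two places sees it. *)
Lemma psum_contraction n f N : (0 < n)%N -> (theta n <= f n.+1)%N ->
  psum (contraction theta n f) N = psum f N + (N == n)%:R * weight n.
Proof.
move=> n0 fn; elim: N => [|N IH].
  by rewrite !psum0 eq_sym gtn_eqF// mul0r addr0.
rewrite !psumS IH /contraction eqSS.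
have [->|Nn] := eqVneq N n.
  rewrite gtn_eqF// !mul0r mul1r natrB// (weightS n0); ring.
have [->|_] := eqVneq N.+1 n; last by ring.
by rewrite natrD !mul0r mul1r; ring.
Qed.

Lemma psum_contractions_ge s f N : applicable theta s f ->
  psum f N <= psum (contractions theta s f) N.
Proof.
elim: s f => //= n s IH f /and3P[n0 fn /IH]; apply: le_trans.
by rewrite psum_contraction// lerDl mulr_ge0 ?weight_ge0.
Qed.

Lemma psum_contractions s f N : applicable theta s f ->
  all (fun n => n < N)%N s -> psum (contractions theta s f) N = psum f N.
Proof.
elim: s f => //= n s IH f /and3P[n0 fn /IH H] /andP[nN /H ->].
by rewrite psum_contraction// gtn_eqF// mul0r addr0.
Qed.

Lemma contractions_nseq t n f : (0 < n)%N -> (t * theta n <= f n.+1)%N ->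
  applicable theta (nseq t n) f /\
  contractions theta (nseq t n) f =1 (fun k => if k == n then f n + t
    else if k == n.+1 then f n.+1 - t * theta n else f k)%N.
Proof.
move=> n0; elim: t f => [|t IH] f H.
  by split=> //= k; do 2?[case: eqP => [->|_]]; rewrite ?addn0 ?subn0.
have cn : contraction theta n f n.+1 = (f n.+1 - theta n)%N.
  by rewrite /contraction eqxx gtn_eqF.
have [|A C] := IH (contraction theta n f); first by rewrite cn; lia.
split=> [/=|k /=]; first by rewrite n0 A andbT; lia.
rewrite C cn /contraction eqxx.
case: eqP => [_|_]; first by lia.
by case: eqP => [_|_]; first by lia.
Qed.

(** Carrying from right to left: at the last place the quotient by theta is moved one place down,
    then the induction treats the shorter prefix. Place 1 has no bound, so nothing is carried out of
    it. *)
Lemma full_contraction M f : exists s, [/\ applicable theta s f,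
  all (fun n => n < M)%N s,
  (forall k, 2 <= k <= M -> contractions theta s f k < theta k.-1)%N &
  forall k, (k == 0)%N || (M < k)%N -> contractions theta s f k = f k].
Proof.
elim: M f => [|M IH] f; first by exists [::]; split=> // k; lia.
case: M IH => [_|M IH]; first by exists [::]; split=> // k; lia.
pose t := (f M.+2 %/ theta M.+1)%N.
have [A C] := @contractions_nseq t M.+1 f isT (leq_trunc_div _ _).
have [s [As alls sb sk]] := IH (contractions theta (nseq t M.+1) f).
exists (nseq t M.+1 ++ s); rewrite applicable_cat A As contractions_cat; split=> //.
- rewrite all_cat all_nseq ltnS leqnn orbT /=.
  by apply: sub_all alls => n /ltnW.
- move=> k /andP[k2]; rewrite leq_eqVlt => /predU1P[->|kM]; last first.
    by apply: sb; rewrite k2.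
  rewrite sk ?ltnSn ?orbT// C gtn_eqF// eqxx /= /t.
  have := htheta (isT : (0 < M.+1)%N) => th.
  by rewrite {1}(divn_eq (f M.+2) (theta M.+1)) addKn ltn_mod; lia.
- move=> k kM; rewrite sk; last by lia.
  by rewrite C; do 2?[case: eqP => [kE|_]]; lia.
Qed.

(** [psum g M + weight M] does not increase with M: a digit below [theta j] at place j+1, plus one,
    weighs at most [theta j * weight j.+1 = weight j]. *)
Lemma psum_digits_slack g n M : (0 < n <= M)%N ->
  (forall k, n < k <= M -> g k < theta k.-1)%N ->
  psum g M + weight M <= psum g n + weight n.
Proof.
move=> /andP[n0 /subnK <-]; elim: (M - n)%N => // j IH gb.
have gj : (g (j + n).+1 < theta (j + n)%N)%N by apply: (gb (j + n).+1); lia.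
apply: le_trans (IH _); last by move=> k kb; apply: gb; lia.
rewrite addSn psumS (@weightS (j + n)%N); last by lia.
rewrite -addrA lerD2l -[X in _ + X]mul1r -mulrDl natr1.
by rewrite ler_wpM2r ?weight_ge0// ler_nat.
Qed.

Lemma digits_bounded_slack h n M : digits_bounded theta h -> (0 < n <= M)%N ->
  psum h M + weight M <= psum h n + weight n.
Proof. by move=> hb nM; apply: psum_digits_slack => // k kb; apply: hb; lia. Qed.

Lemma digits_bounded_finite h : digits_bounded theta h -> finite_fun h.
Proof.
move=> hb; exists (psum h 1 + weight 1) => -[|N].
  by rewrite psum0 addr_ge0 ?psum_ge0 ?weight_ge0.
apply: le_trans (digits_bounded_slack (M := N.+1) hb _) => //.
by rewrite lerDl weight_ge0.
Qed.

Lemma digits_bounded_value_le h n : digits_bounded theta h -> (0 < n)%N ->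
  value h <= psum h n + weight n.
Proof.
move=> hb n0; apply: value_le => N.
apply: le_trans (psum_le h (leq_maxr n N)) _.
apply: le_trans (digits_bounded_slack (M := maxn n N) hb _).
  by rewrite lerDl weight_ge0.
by rewrite n0 leq_maxl.
Qed.

(** * Contracting a function to a digit sequence *)

Definition contracts_to (f h : nat -> nat) := forall N, (0 < N)%N ->
  exists s, applicable theta s f /\
    forall n, (n <= N)%N -> contractions theta s f n = h n.

Lemma contractions0 s f : applicable theta s f -> contractions theta s f 0 = f 0%N.
Proof.
elim: s f => //= n s IH f /and3P[n0 _ /IH ->].
by rewrite /contraction ltn_eqF// .
Qed.

Lemma contracts_to0 f h : contracts_to f h -> f 0%N = h 0%N.
Proof.
move=> /(_ 1%N isT) [s [As /(_ 0%N isT) <-]].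
by rewrite contractions0.
Qed.

Lemma contracts_to_psum_le f h N : contracts_to f h -> psum f N <= psum h N.
Proof.
case: N => [|N] fh; first by rewrite !psum0.
have [s [As sh]] := fh N.+1 isT.
apply: le_trans (psum_contractions_ge _ As) _.
by rewrite (@eq_psum _ h)// => n /andP[_ /sh].
Qed.

Lemma contracts_to_finite f h : finite_fun h -> contracts_to f h -> finite_fun f.
Proof.
by move=> [B hB] fh; exists B => N; apply: le_trans (hB N); apply: contracts_to_psum_le.
Qed.

(** Contractions move weight to the left, so partial sums of f stay below those of h. Conversely, a
    finite sequence of contractions leaves unchanged every partial sum reaching beyond its largest
    index. *)
Lemma contracts_to_value f h : finite_fun h -> contracts_to f h ->
  value f = value h.
Proof.
move=> fh fch; have ff := contracts_to_finite fh fch; apply/le_anti/andP; split.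
  apply: value_le => N; apply: le_trans (psum_le_value N fh).
  exact: contracts_to_psum_le.
apply: value_le => -[|N]; first by rewrite psum0 value_ge0.
have [s [As sh]] := fch N.+1 isT.
pose M := maxn N.+1 (\max_(n <- s) n).+1.
rewrite -(@eq_psum (contractions theta s f)); last by move=> n /andP[_ /sh].
apply: le_trans (psum_le_value M ff).
rewrite -(psum_contractions As); first by rewrite psum_le// leq_maxl.
apply/allP => n ns; rewrite /M leq_max ltnS; apply/orP; right.
exact: (@leq_bigmax_seq _ s xpredT id n ns isT).
Qed.

Lemma bounded_eventually_constant (u : nat -> nat) K B :
  (forall M M', K <= M <= M' -> u M <= u M')%N -> (forall M, (K <= M)%N -> (u M <= B)%N) ->
  exists d K', forall M, (K' <= M)%N -> u M = d.
Proof.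
move: (leqnn (B - u K)%N); move: {2}(B - u K)%N => m.
elim: m K => [|m IH] K Km umono uB.
  exists (u K), K => M KM; have := uB M KM.
  have : (u K <= u M)%N by apply: umono; rewrite leqnn.
  by lia.
have [[M [KM uM]]|noM] := pselect (exists M, (K <= M)%N /\ (u K < u M)%N).
  apply: (IH M); first by have := uB M KM; lia.
    by move=> M1 M2 M12; apply: umono; lia.
  by move=> M' MM; apply: uB; lia.
exists (u K), K => M KM; apply/eqP; rewrite eqn_leq; apply/andP; split.
  by rewrite leqNgt; apply/negP => uKM; apply: noM; exists M.
by apply: umono; rewrite leqnn.
Qed.

(* Fully contracting the first M places gives the digits of psum f M; since
   psum f is bounded and nondecreasing, each digit stabilises as M grows. *)
Lemma finite_contracts_to f : finite_fun f ->
  exists h, digits_bounded theta h /\ contracts_to f h.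
Proof.
move=> ff; have [s sP] := choice (fun M => full_contraction M f).
pose g M := contractions theta (s M) f.
have gf M : psum (g M) M = psum f M by apply: psum_contractions; case: (sP M).
have gb M k : (2 <= k <= M)%N -> (g M k < theta k.-1)%N by case: (sP M) => _ _ + _; apply.
have stab n : exists d K, forall M, (K <= M)%N -> g M n = d.
  have [m nm] := ubnP n; elim: m n nm => // m IH n nm.
  case: n nm => [|n] nm.
    by exists (f 0%N), 0%N => M _; case: (sP M) => _ _ _; apply.
  (* A common stage K after which all places up to n are constant. *)
  have [K KP] : exists K, forall M M' k, (K <= M)%N -> (K <= M')%N -> (k <= n)%N ->
      g M k = g M' k.
    have : forall k, (k <= n)%N -> exists d K, forall M, (K <= M)%N -> g M k = d.
      by move=> k kn; apply: IH; lia.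
    move: (n) => n'; elim: n' => [|n' IHn] H.
      have [d [K KP]] := H 0%N isT; exists K => M M' k KM KM'.
      by rewrite leqn0 => /eqP ->; rewrite !KP.
    have [|K KP] := IHn; first by move=> k kn; apply: H; lia.
    have [d [K' KP']] := H n'.+1 (leqnn _); exists (maxn K K') => M M' k KM KM'.
    rewrite leq_eqVlt => /predU1P[->|kn]; first by rewrite !KP'//; lia.
    by apply: KP => //; lia.
  (* The bound comes from [g M n.+1 * weight n.+1 <= psum f M <= value f]. Monotonicity holds
     because the places up to n no longer change. *)
  apply: (@bounded_eventually_constant _ (maxn K n.+1)
    (Num.truncn (value f / weight n.+1))).
    move=> M M' /andP[KM MM'].
    have E : psum (g M) n = psum (g M') n.
      by apply: eq_psum => k kn; apply: KP; lia.
    have H1 : psum (g M) n.+1 <= psum (g M') M'.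
      rewrite gf; apply: le_trans (psum_le f MM'); rewrite -gf psum_le//; lia.
    have H2 : psum (g M') M' + weight M' <= psum (g M') n.+1 + weight n.+1.
      apply: psum_digits_slack; first by lia.
      by move=> k kM; apply: gb; lia.
    have wM := weight_gt0 M'.
    (* The leftover [weight M'] makes the inequality strict, and for integers x < y + 1 means x <=
       y. *)
    have : (g M n.+1)%:R * weight n.+1 < (g M' n.+1).+1%:R * weight n.+1.
      move: H1 H2; rewrite !psumS E -natr1 mulrDl mul1r; lra.
    by rewrite ltr_pM2r ?weight_gt0// ltr_nat ltnS.
  move=> M KM; rewrite -(@natrK R (g M n.+1)) le_truncn//.
  rewrite ler_pdivlMr ?weight_gt0//.
  apply: le_trans (psum_le_value M ff); rewrite -gf.
  apply: (@le_trans _ _ (psum (g M) n.+1)); last by rewrite psum_le//; lia.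
  by rewrite psumS lerDr psum_ge0.
have [h hP] := choice stab; have [K KP] := choice hP.
have [KK KKP] : exists KK : nat -> nat, forall N n, (n <= N)%N -> (K n <= KK N)%N.
  by exists (fun N => \max_(n < N.+1) K n)%N => N n nN;
     exact: (@leq_bigmax _ (fun i : 'I_N.+1 => K i) (Ordinal (nN : (n < N.+1)%N))).
exists h; split=> [k k2|N N0].
  by rewrite -(KP k (maxn k (K k))) ?leq_maxr// gb// k2 leq_maxl.
exists (s (KK N)); split=> [|n nN]; first by case: (sP (KK N)).
by rewrite -(KP n (KK N))// KKP.
Qed.

(** * The base set *)

Lemma primary_not_maximal h N : primary_aux theta h -> ~ maximal_after theta h N.
Proof. by move=> [_ hp] [/hp[M [NM hM]] /(_ M NM)]. Qed.

(** The analogue of 0.999... = 1: the maximal digits of [p.2] after N telescope to [weight N], the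
    extra unit that [p.1] has at N. *)
Lemma W1_value p : W1 theta p -> value p.1 = value p.2.
Proof.
move=> [[b1 _] [[b2 _] [N [[[N0 mx] _] [lt [eN gt]]]]]].
have f1 := digits_bounded_finite b1; have f2 := digits_bounded_finite b2.
have E : psum p.1 N = psum p.2 N + weight N.
  rewrite -(prednK N0) !psumS (prednK N0) eN natrD mulrDl mul1r addrA.
  by congr (_ + _ + _); apply: eq_psum => n nN; apply: lt; lia.
have T1 j : psum p.1 (j + N) = psum p.1 N.
  by elim: j => // j IH; rewrite addSn psumS IH gt ?mul0r ?addr0//; lia.
have T2 j : psum p.2 (j + N) + weight (j + N) = psum p.2 N + weight N.
  elim: j => // j IH; rewrite -IH addSn psumS mx; last by lia.
  have jN : (0 < j + N)%N by lia.
  rewrite (weightS jN) subn1 -addrA -[X in _ + (_ + X)]mul1r -mulrDl natr1.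
  by rewrite /= prednK// (leq_trans _ (htheta jN)).
apply/le_anti/andP; split.
  apply: value_le => M; apply: le_trans (psum_le _ (leq_addr N M)) _.
  rewrite T1 E; apply: (@le_of_weight_slack _ _ 1 N) => K NK.
  rewrite -(T2 (K - N)%N) subnK// mul1r lerD2r; exact: psum_le_value.
apply: value_le => M; apply: le_trans (psum_le _ (leq_addr N M)) _.
apply: le_trans (psum_le_value N f1).
by rewrite E -(T2 M) lerDl weight_ge0.
Qed.

Lemma W1_sign p : W1 theta p -> sign p.1 = sign p.2.
Proof.
by move=> [_ [_ [N [[[N0 _] _] [lt _]]]]]; rewrite /sign lt.
Qed.

Lemma aux_equiv_value h h' : aux_equiv h h' -> value h = value h'.
Proof. by move=> [E _]; apply: eq_value. Qed.

(** At the first difference N, say [h N < h' N], equal values force [value h] to reach its upper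
    bound [psum h N + weight N]. Then all later digits of h are maximal, which a primary function
    excludes. *)
Lemma primary_value_inj h h' : primary_aux theta h -> primary_aux theta h' ->
  value h = value h' -> forall n, (0 < n)%N -> h n = h' n.
Proof.
move=> ph ph' vE n n0; apply/eqP; apply: contrapT => /negP hn.
have ex : exists n, (0 < n)%N && (h n != h' n) by exists n; rewrite n0.
case: (ex_minnP ex) => N /andP[N0 hN] Nmin.
have eqN k : (0 < k < N)%N -> h k = h' k.
  move=> /andP[k0 kN]; apply/eqP; apply/negPn/negP => hk.
  by have := Nmin k; rewrite k0 hk => /(_ isT); rewrite leqNgt kN.
clear hn ex Nmin; wlog lt : h h' ph ph' vE hN eqN / (h N < h' N)%N.
  move=> H; have [|//|E] := ltngtP (h N) (h' N).
    exact: (H h h').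
    by apply: (H h' h) => //; [rewrite eq_sym|move=> k /eqN].
  by rewrite E eqxx in hN.
apply: (@primary_not_maximal h N ph); split=> // M NM.
have [hb hb'] := (ph.1, ph'.1).
apply/eqP; apply: contrapT => /negP hM.
have M0 : (0 < M.-1)%N by lia.
(* A non-maximal digit at M costs a further [weight M], which contradicts the equality of values. *)
have lt2 : (h M + 2 <= theta M.-1)%N.
  have := hb M; have := htheta M0; move: hM; lia.
have H1 := digits_bounded_value_le hb (leq_ltn_trans (leq0n N) NM).
have H2 : psum h M.-1 + weight M.-1 <= psum h N + weight N.
  by apply: digits_bounded_slack => //; lia.
have H3 : psum h N + weight N <= psum h' N.
  rewrite -(prednK N0) !psumS (prednK N0) -addrA -[X in _ + (_ + X)]mul1r.
  rewrite -mulrDl natr1 (@eq_psum h h'); last by move=> k kN; apply: eqN; lia.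
  by rewrite lerD2l ler_wpM2r ?weight_ge0// ler_nat.
have H4 := psum_le_value N (digits_bounded_finite hb').
have H5 : psum h M + 2 * weight M <= psum h M.-1 + weight M.-1.
  rewrite (weightS M0) prednK; last by lia.
  rewrite -{1}(@prednK M); last by lia.
  rewrite psumS prednK; last by lia.
  by rewrite -addrA -mulrDl lerD2l ler_wpM2r ?weight_ge0// -natrD ler_nat.
have := weight_gt0 M; lra.
Qed.

(** Membership in a pair of [W1] survives a change of the value at 0, made in both components since
    N > 0. Hence no element of [W2] is equivalent to a first component. *)
Lemma W1_change0 p h : W1 theta p -> primary_aux theta h ->
  (forall n, (0 < n)%N -> p.1 n = h n) ->
  exists q, W1 theta q /\ q.1 = h.
Proof.
move=> [_ [[b2 [N' mN']] [N [[[N0 mN] Nmin] [lt [eN gt]]]]]] ph E.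
pose hs n := if n == 0%N then h 0%N else p.2 n.
have hsE n : (0 < n)%N -> hs n = p.2 n by case: n.
have mE K : maximal_after theta hs K <-> maximal_after theta p.2 K.
  split=> -[K0 KP]; split=> // M KM; first by rewrite -hsE ?KP//; lia.
  by rewrite hsE ?KP//; lia.
exists (h, hs); split=> //; split=> //=; split.
  split; last by exists N'; apply/mE.
  by move=> k k2; rewrite hsE ?b2//; lia.
exists N; split; first by split=> [|K /mE]; [apply/mE|apply: Nmin].
split=> [[|k] kN //|]; first by rewrite -E// lt.
split=> [|k kN]; first by rewrite -E // hsE.
by rewrite -E ?gt//; lia.
Qed.

(** The last clause says that a base element is determined by the equivalence class of its primary
    members; [W1_change0] rules out one class meeting both [F_sets] and [G2_sets]. *)
Lemma base_primary b : base_set theta b -> exists p, [/\ primary_aux theta p, b p,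
  (forall h, b h -> [/\ digits_bounded theta h, value h = value p & sign h = sign p]) &
  forall p', primary_aux theta p' -> aux_equiv p p' -> forall b',
    base_set theta b' -> b' p' -> b = b'].
Proof.
have Fcls p q : W1 theta p -> W1 theta q -> aux_equiv p.1 q.1 ->
    [set h | exists q, W1 theta q /\ aux_equiv p.1 q.1 /\ (h = q.1 \/ h = q.2)] =
    [set h | exists q', W1 theta q' /\ aux_equiv q.1 q'.1 /\ (h = q'.1 \/ h = q'.2)].
  move=> Wp Wq [E S]; apply/seteqP; split=> h [r [Wr [[E' S'] hr]]]; exists r;
    split=> //; split=> //; split=> [n n0|].
  - by rewrite -E ?E'.
  - by rewrite -S' S.
  - by rewrite E ?E'.
  - by rewrite S -S'.
have memF p p' : primary_aux theta p' ->
    (exists q, W1 theta q /\ aux_equiv p q.1 /\ (p' = q.1 \/ p' = q.2)) ->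
    aux_equiv p p' /\ exists q, W1 theta q /\ q.1 = p'.
  move=> pp' [q [Wq [pq [->|E]]]]; first by split=> //; exists q.
  by case: Wq => _ [[_ [N]]]; rewrite -E => /(primary_not_maximal pp').
move=> [[p [Wp ->]]|[h [Wh ->]]].
  exists p.1; split; first by case: Wp.
  - by exists p; do 2?split=> //; left.
  - move=> h [q [Wq [pq hq]]]; have [d1 d2] : digits_bounded theta q.1 /\
      digits_bounded theta q.2 by case: Wq => -[? _] [[? _] _].
    rewrite (aux_equiv_value pq) pq.2.
    by case: hq => ->; split=> //; rewrite ?W1_value// W1_sign.
  move=> p' pp' pE b' [[q [Wq ->]]|[h [Wh ->]]] /=.
    move=> /(memF _ _ pp')[[E S] _]; apply: Fcls => //.
    by split=> [n n0|]; rewrite ?pE.1 ?E// pE.2 S.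
  move=> [Wp' _]; have [q [Wq qE]] := W1_change0 Wp pp' pE.1.
  by case: (Wp'.2 q Wq); rewrite qE.
exists h; split; first by case: Wh.
- by [].
- move=> h' [Wh' hh']; rewrite (aux_equiv_value hh') hh'.2.
  by split=> //; case: Wh' => -[].
move=> p' pp' hE b' [[q [Wq ->]]|[h' [Wh' ->]]] /=.
  move=> /(memF _ _ pp')[_ [r [Wr rE]]].
  have [n n0|s [Ws sE]] := W1_change0 Wr Wh.1.
    by rewrite rE hE.1.
  by case: (Wh.2 s Ws); rewrite sE.
move=> [_ h'p']; apply/seteqP; split=> k [Wk [E S]]; split=> //; split.
- by move=> n n0; rewrite h'p'.1// -hE.1// E.
- by rewrite h'p'.2 -hE.2.
- by move=> n n0; rewrite hE.1// -h'p'.1// E.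
- by rewrite hE.2 -h'p'.2.
Qed.

Lemma base_digits_bounded b h : base_set theta b -> b h -> digits_bounded theta h.
Proof. by move=> /base_primary[p [_ _ + _]] bh => /(_ h bh)[]. Qed.

Lemma base_value b h h' : base_set theta b -> b h -> b h' -> value h = value h'.
Proof.
by move=> /base_primary[p [_ _ H _]] /H[_ -> _] /H[_ -> _].
Qed.

Lemma base_sign b h h' : base_set theta b -> b h -> b h' -> sign h = sign h'.
Proof.
by move=> /base_primary[p [_ _ H _]] /H[_ _ ->] /H[_ _ ->].
Qed.

Lemma base_inj b b' h h' : base_set theta b -> base_set theta b' ->
  b h -> b' h' -> value h = value h' -> sign h = sign h' -> b = b'.
Proof.
move=> Bb Bb' bh bh'.
have [p [pp bp /(_ h bh)[_ -> ->] U]] := base_primary Bb.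
have [p' [pp' bp' /(_ h' bh')[_ -> ->] _]] := base_primary Bb'.
move=> vE sE; apply: (U p') => //; split=> //.
exact: primary_value_inj.
Qed.

(** A primary h outside all pairs lies in [W2]. Any other h in no pair would be secondary, and
    rounding it up at its least N produces a pair containing it. *)
Lemma digits_bounded_in_base h : digits_bounded theta h ->
  exists b, base_set theta b /\ b h.
Proof.
move=> hb; have [[p [Wp hp]]|noW] := pselect (exists p, W1 theta p /\ (h = p.1 \/ h = p.2)).
  exists [set h | exists q, W1 theta q /\ aux_equiv p.1 q.1 /\ (h = q.1 \/ h = q.2)].
  by split; [left; exists p|exists p].
have [ph|] := pselect (primary_aux theta h).
  have W : W2 theta h.
    by split=> // p Wp; split=> hE; apply: noW; exists p; split=> //; [left|right].
  by exists [set h' | W2 theta h' /\ aux_equiv h h']; split; [right; exists h|].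
move=> nph; have ex : exists N, `[< maximal_after theta h N >].
  apply: contrapT => nex; apply: nph; split=> // N N0.
  apply: contrapT => nM; apply: nex; exists N; apply/asboolP; split=> // M NM.
  by apply: contrapT => hM; apply: nM; exists M.
case: (ex_minnP ex) => N /asboolP mN Nmin; have [N0 hN] := mN.
exfalso; apply: noW.
pose p n := if (n < N)%N then h n else if n == N then (h N + 1)%N else 0%N.
have pE n : (N < n)%N -> p n = 0%N by move=> Nn; rewrite /p ltnNge ltnW//= gtn_eqF.
exists (p, h); split; last by right.
split=> /=.
  split=> [k k2|K K0].
    have kth : (2 <= theta k.-1)%N by apply: htheta; lia.
    rewrite /p; case: ifP => [_|_]; first exact: hb.
    case: eqP => [kN|_]; last by lia.
    (* If [h N] were already maximal, N-1 would also work, against minimality; so [h N + 1] is still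
       an admissible digit. *)
    have := hb k k2; rewrite leq_eqVlt => /predU1P[hk|]; last by rewrite kN addn1.
    have /Nmin : `[< maximal_after theta h N.-1 >]; last by lia.
    apply/asboolP; split=> [|M]; first by lia.
    rewrite prednK// leq_eqVlt => /predU1P[<-|/hN//].
    by rewrite -kN -hk subn1.
  exists (maxn K N).+1; split; first by lia.
  rewrite pE; last by lia.
  have : (2 <= theta (maxn K N))%N by apply: htheta; lia.
  by rewrite /=; lia.
split; first by split=> //; exists N.
exists N; split; first by split=> // K mK; apply: Nmin; apply/asboolP.
by split=> [k kN|]; rewrite /p ?kN// ltnn eqxx; split=> // k Nk; exact: pE.
Qed.

Lemma r_setE b h : base_set theta b -> b h ->
  r_set theta b = [set f | [/\ finite_fun f, value f = value h & sign f = sign h]].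
Proof.
move=> Bb bh; apply/seteqP; split=> f.
  move=> [h' [bh' fh']].
  have fin := digits_bounded_finite (base_digits_bounded Bb bh').
  split; first exact: contracts_to_finite fh'.
    by rewrite (contracts_to_value fin fh') (base_value Bb bh' bh).
  by rewrite -(base_sign Bb bh' bh) /sign (contracts_to0 fh').
(* The digit sequence h' obtained from f lies in some base element, which [base_inj] identifies with
   b. *)
move=> [ff vE sE]; have [h' [hb fh']] := finite_contracts_to ff.
have [b' [Bb' b'h']] := digits_bounded_in_base hb.
have -> : b = b'; last by exists h'.
apply: (base_inj Bb Bb' bh b'h').
  by rewrite -vE (contracts_to_value (digits_bounded_finite hb) fh').
by rewrite -sE /sign (contracts_to0 fh').
Qed.

(** * Real numbers *)

(** The sign is ignored at value 0, so that the class of zero merges the two signed zeros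
    [r_set theta (b1 theta)] and [r_set theta (b2 theta)]. *)
Definition real_class (f : nat -> nat) : set (nat -> nat) :=
  [set g | [/\ finite_fun g, value g = value f & value f = 0 \/ sign g = sign f]].

Lemma real_class_refl f : finite_fun f -> real_class f f.
Proof. by move=> ff; split=> //; right. Qed.

Lemma real_class_eq f g : real_class f g -> real_class f = real_class g.
Proof.
move=> [fg vE sE]; apply/seteqP; split=> h [fh vh sh]; split=> //.
- by rewrite vh.
- by rewrite vE; case: sh => [?|->]; [left|case: sE => [?|->]; [left|right]].
- by rewrite vh.
- by rewrite -vE; case: sh => [?|->]; [left|case: sE => [?|->]; [left; rewrite vE|right]].
Qed.

Lemma base_eltP h : digits_bounded theta h ->
  base_set theta (base_elt theta h) /\ base_elt theta h h.
Proof.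
move=> /digits_bounded_in_base ex.
exact: (@xgetPex _ set0 [set b | base_set theta b /\ b h] ex).
Qed.

Lemma value_zero_on_pos f : (forall n, (0 < n)%N -> f n = 0%N) ->
  finite_fun f /\ value f = 0.
Proof.
move=> f0; have ff : finite_fun f.
  by exists 0 => N; rewrite /psum big_nat big1// => n /andP[/f0->]; rewrite mul0r.
by split=> //; apply/(finite_value_eq0 ff).
Qed.

Lemma r_set_class b h : base_set theta b -> b h -> value h != 0 ->
  r_set theta b = real_class h.
Proof.
move=> Bb bh /eqP h0; rewrite (r_setE Bb bh); apply/seteqP.
by split=> f [ff vE sE]; split=> //; [right|case: sE].
Qed.

Lemma zero_digits_bounded f : (forall n, (0 < n)%N -> f n = 0%N) ->
  digits_bounded theta f.
Proof. by move=> f0 k k2; rewrite f0 ?(ltnW k2)// ltnW// htheta; lia. Qed.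

Lemma b1P : base_set theta (b1 theta) /\ b1 theta (fun=> 0%N).
Proof. exact/base_eltP/zero_digits_bounded. Qed.

Lemma b2P : base_set theta (b2 theta) /\ b2 theta (fun n => if n == 0%N then 1%N else 0%N).
Proof. by apply/base_eltP/zero_digits_bounded => -[]. Qed.

Lemma real_zeroE : real_zero theta = real_class (fun=> 0%N).
Proof.
have [B1 h1] := b1P; have [B2 h2] := b2P.
have [_ v1] := @value_zero_on_pos (fun=> 0%N) (fun _ _ => erefl).
have [|_ v2] := @value_zero_on_pos (fun n => if n == 0%N then 1%N else 0%N).
  by case.
rewrite /real_zero (r_setE B1 h1) (r_setE B2 h2) v1 v2; apply/seteqP; split=> f.
  by case=> -[ff vf _]; split=> //; rewrite ?v1//; left.
move=> [ff]; rewrite v1 => vf _; case E : (odd (f 0%N)); [right|left];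
  by split=> //; rewrite /sign E.
Qed.

Lemma real_class_zero f : finite_fun f ->
  real_class f = real_zero theta <-> value f = 0.
Proof.
have [f0 v0] := @value_zero_on_pos (fun=> 0%N) (fun _ _ => erefl).
move=> ff; rewrite real_zeroE; split=> [E|vf].
  by have := real_class_refl ff; rewrite E => -[_ -> _].
by apply: real_class_eq; split=> //; [rewrite v0 vf|left].
Qed.

Lemma real_numbers_class f : finite_fun f -> real_numbers theta (real_class f).
Proof.
move=> ff; have [v0|v0] := eqVneq (value f) 0.
  by right; apply/real_class_zero.
have [h [hb fh]] := finite_contracts_to ff.
have [b [Bb bh]] := digits_bounded_in_base hb.
have vE := contracts_to_value (digits_bounded_finite hb) fh.
left; exists b; split=> //.
have nb b' h' : base_set theta b' -> b' h' -> (forall n, (0 < n)%N -> h' n = 0%N) ->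
    b <> b'.
  move=> Bb' b'h' /value_zero_on_pos[_ vh'] bb'; move: v0.
  by rewrite vE (@base_value b' h h')// -?bb'// vh' eqxx.
split; first exact: (nb _ _ b1P.1 b1P.2).
split; first by apply: (nb _ _ b2P.1 b2P.2) => -[].
rewrite (r_set_class Bb bh) -?vE//; apply: real_class_eq; split=> //.
  exact: digits_bounded_finite.
by right; rewrite /sign (contracts_to0 fh).
Qed.

Lemma real_numbersP x : real_numbers theta x ->
  exists f, finite_fun f /\ x = real_class f.
Proof.
move=> [[b [Bb [nb1 [nb2 ->]]]]|->]; last first.
  exists (fun=> 0%N); rewrite real_zeroE; split=> //.
  by case: (@value_zero_on_pos (fun=> 0%N)).
have [p [_ bp _ _]] := base_primary Bb.
have fp := digits_bounded_finite (base_digits_bounded Bb bp).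
exists p; split=> //; apply: (r_set_class Bb bp); apply/eqP => v0.
have [E|E] := boolP (odd (p 0%N)).
  apply: nb2; apply: (base_inj Bb b2P.1 bp b2P.2); last by rewrite /sign E.
  by have [|_ ->] := @value_zero_on_pos (fun n => if n == 0%N then 1%N else 0%N); [case|].
apply: nb1; apply: (base_inj Bb b1P.1 bp b1P.2); last by rewrite /sign (negPf E).
by rewrite v0; case: (@value_zero_on_pos (fun=> 0%N)).
Qed.

Lemma real_sign_class f : finite_fun f -> value f <> 0 ->
  real_sign (real_class f) = sign f.
Proof.
move=> ff v0; have ex : exists s, [set s | forall g, real_class f g -> sign g = s] s.
  by exists (sign f) => g [_ _ []].
exact/esym/(xgetPex 0%N ex _ (real_class_refl ff)).
Qed.

Lemma sign_subproduct f g : sign (subproduct theta f g) =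
  (if sign f == sign g then 1 else 0)%N.
Proof. by rewrite /sign /subproduct /= oddD; do 2!case: odd. Qed.

Lemma real_mul_class f g : finite_fun f -> finite_fun g ->
  real_mul theta (real_class f) (real_class g) = real_class (subproduct theta f g).
Proof.
move=> ff fg; have ffg := finite_subproduct ff fg.
have ex : exists z, [set z | real_numbers theta z /\ forall f' g', real_class f f' ->
    real_class g g' -> z (subproduct theta f' g')] z.
  exists (real_class (subproduct theta f g)); split; first exact: real_numbers_class.
  move=> f' g' [ff' vf sf] [fg' vg sg]; split; first exact: finite_subproduct.
    by rewrite !value_subproduct// vf vg.
  rewrite value_subproduct//; case: sf => [->|sf]; first by left; rewrite mul0r.
  case: sg => [->|sg]; first by left; rewrite mulr0.
  by right; rewrite !sign_subproduct sf sg.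
(* Whatever real number [xget] picks is a class containing [subproduct theta f g], and classes that
   meet coincide. *)
have [/real_numbersP[h [fh E]] H] := xgetPex set0 ex.
rewrite -/(real_mul theta (real_class f) (real_class g)) in E H.
by rewrite E in H *; apply/real_class_eq/H; apply: real_class_refl.
Qed.

(** * Monotonicity of multiplication *)

Lemma subproduct_leq f g k n : (forall n, (0 < n)%N -> (f n <= g n)%N) ->
  (0 < n)%N -> (subproduct theta f k n <= subproduct theta g k n)%N.
Proof.
move=> fg n0; rewrite /subproduct eqn0Ngt n0 /= big_nat [leqRHS]big_nat.
apply: leq_sum => i /andP[i0 _]; apply: leq_sum => j _.
by rewrite !leq_mul// fg.
Qed.

Lemma real_class_subproduct_dominated f g g' k F :
  finite_fun f -> finite_fun g -> finite_fun k -> real_class g g' ->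
  (forall n, (0 < n)%N -> (f n <= g' n)%N) ->
  real_class (subproduct theta f k) F ->
  exists G, real_class (subproduct theta g k) G /\
    forall n, (0 < n)%N -> (F n <= G n)%N.
Proof.
move=> ff fg fk [fg' vg' _] fg'le [fF vF _].
pose D n := (subproduct theta g' k n - subproduct theta f k n)%N.
(* The value at 0 gives G the sign of [subproduct theta g k]; elsewhere D, an exact difference by
   [subproduct_leq], supplies the missing value. *)
pose G n := if n == 0%N then subproduct theta g k 0 else (F n + D n)%N.
have fgk := finite_subproduct fg' fk; have ffk := finite_subproduct ff fk.
have fD : finite_fun D.
  by apply: finite_leq fgk => n _; rewrite leq_subr.
have vD : value (subproduct theta g' k) = value (subproduct theta f k) + value D.
  rewrite -valueD//; apply: eq_value => n n0.
  by rewrite subnKC// subproduct_leq.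
have GE n : (0 < n)%N -> (F n + D n)%N = G n by case: n.
exists G; split=> [|n n0]; last by rewrite -GE// leq_addr.
split; first exact: eq_finite GE (finiteD fF fD).
  rewrite -(eq_value GE) valueD// vF -vD !value_subproduct//.
  by rewrite vg'.
by right.
Qed.

(** Multiplication by k preserves both sign and vanishing, so each clause of the order is carried to
    the same clause for the products. *)
Lemma real_le_mul_class f g k : finite_fun f -> finite_fun g -> finite_fun k ->
  value k <> 0 -> sign k = 1%N ->
  real_le theta (real_class f) (real_class g) ->
  real_le theta (real_class (subproduct theta f k)) (real_class (subproduct theta g k)).
Proof.
move=> ff fg fk k0 sk.
have sgn h : sign (subproduct theta h k) = sign h.
  by rewrite sign_subproduct sk /sign; case: odd.
have fin h : finite_fun h -> finite_fun (subproduct theta h k).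
  by move=> fh; apply: finite_subproduct.
have val0 h : finite_fun h -> value (subproduct theta h k) = 0 <-> value h = 0.
  move=> fh; rewrite value_subproduct//; split=> [/eqP|->]; last by rewrite mul0r.
  by rewrite mulf_eq0 => /orP[/eqP//|/eqP].
have nz h : finite_fun h -> real_class h <> real_zero theta -> value h <> 0.
  by move=> fh hn v0; apply/hn/real_class_zero.
have zE h : finite_fun h -> (real_class (subproduct theta h k) = real_zero theta) =
    (real_class h = real_zero theta).
  move=> fh; apply/propext.
  by rewrite !real_class_zero//; [exact: val0|exact: fin].
have sE h : finite_fun h -> real_class h <> real_zero theta ->
    real_sign (real_class (subproduct theta h k)) = real_sign (real_class h).
  move=> fh hn; have v0 := nz h fh hn.
  rewrite !real_sign_class//; first exact: fin.
  by move=> /(val0 _ fh).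
rewrite /real_le /= !zE// => -[[fn [gn H]]|[[fn [gz H]]|[[fz [gn H]]|[fz gz]]]].
- left; split=> //; split=> //; rewrite /real_le_nonzero !sE//.
  case: H => [H|[[s1 [s2 H]]|[s1 [s2 H]]]]; first by left.
    right; left; split=> //; split=> // F FP.
    (* A witness for the single representative f serves every F in the product class. *)
    have [g' [gg' le]] := H f (real_class_refl ff).
    exact: (real_class_subproduct_dominated ff fg fk gg' le FP).
  right; right; split=> //; split=> // F FP.
  (* For negative numbers the roles of f and g are exchanged. *)
  have [g' [gg' le]] := H g (real_class_refl fg).
  exact: (real_class_subproduct_dominated fg ff fk gg' le FP).
- by right; left; rewrite sE.
- by right; right; left; rewrite sE.
- by do 3!right.
Qed.

End Value.

Theorem mainTheorem14 (theta : nat -> nat) (htheta : system_function theta)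
    (a b c : set (nat -> nat))
    (ha : real_numbers theta a) (hb : real_numbers theta b)
    (hab : real_le theta a b)
    (hc : real_numbers theta c) (hc0 : c <> real_zero theta)
    (hsc : real_sign c = 1) :
  real_le theta (real_mul theta a c) (real_mul theta b c).
Proof.
(* Values are taken in the standard reals, made a [realType] by [Rstruct]. *)
have [f [ff fE]] := real_numbersP Rdefinitions.R htheta ha.
have [g [fg gE]] := real_numbersP Rdefinitions.R htheta hb.
have [k [fk kE]] := real_numbersP Rdefinitions.R htheta hc.
move: hab hc0 hsc; rewrite fE gE kE !real_mul_class// => le nz sk.
have k0 : value Rdefinitions.R theta k <> 0%R.
  by move=> v0; apply/nz/real_class_zero.
apply: real_le_mul_class => //.
by rewrite -(real_sign_class fk k0).
Qed.
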